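(* Let $\{\psi_j\}_{j=0}^d$ be a basis of $\mathbb W$. For each $j\in\{0,\dots,d\}$, assume there exists an index $i(j)\in\{0,\dots,d\}$ such that $(I-\Pi_{1,\omega_j})(\psi_{i(j)}|_{F_j})\neq0$. Define $$q_j^\star=\arg\max_{\substack{q\in\mathbb S_2(F_j)\\ \|q\|_{\omega_j}=1}}\left|\langle\psi_{i(j)}|_{F_j},q\rangle_{\omega_j}\right|.$$ Then the maximizer exists, is unique up to sign, and is given (up to sign) by $$q_j^\star=\frac{(I-\Pi_{1,\omega_j})(\psi_{i(j)}|_{F_j})}{\left\|(I-\Pi_{1,\omega_j})(\psi_{i(j)}|_{F_j})\right\|_{\omega_j}}.$$ In particular, $q_j^\star\in\mathbb S_2(F_j)$ and $\|q_j^\star\|_{\omega_j}=1$.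
   Context: Let $d\ge2$ and let $S_d\subset\mathbb R^d$ be a nondegenerate $d$-simplex with vertices $\boldsymbol v_0,\dots,\boldsymbol v_d$ and barycentric coordinates $\lambda_0,\dots,\lambda_d$; $F_j$ is the face opposite $\boldsymbol v_j$. $\mathbb P_k(X)$ is the space of (restrictions to $X$ of) polynomials of total degree at most $k$. $\Omega\in L^1(S_d)$ is a probability density, strictly positive a.e. in the interior of $S_d$. The induced face density $\omega_j\in L^1(F_j)$ is the probability density on $F_j$, assumed to exist and to be positive a.e. on $F_j$, such that for every $\phi$ continuous on $F_j$ (extended continuously to $S_d$), $\int_{F_j}\phi\,\omega_j\,d\boldsymbol x=\lim_{\varepsilon\to0^+}\int_{\{\lambda_j<\varepsilon\}}\phi\,\Omega\,d\boldsymbol\sigma\big/\int_{\{\lambda_j<\varepsilon\}}\Omega\,d\boldsymbol\sigma$. Set $\langle f,g\rangle_\Omega=\int_{S_d}fg\,\Omega\,d\boldsymbol\sigma$, $\langle f,g\rangle_{\omega_j}=\int_{F_j}fg\,\omega_j\,d\boldsymbol x$, $\|f\|_{\omega_j}^2=\langle f,f\rangle_{\omega_j}$. $\mathbb S_2(S_d)$ (resp. $\mathbb S_2(F_j)$) is the orthogonal complement of $\mathbb P_1(S_d)$ in $\mathbb P_2(S_d)$ with respect to $\langle\cdot,\cdot\rangle_\Omega$ (resp. of $\mathbb P_1(F_j)$ in $\mathbb P_2(F_j)$ with respect to $\langle\cdot,\cdot\rangle_{\omega_j}$). $\mathbb W\subset\mathbb S_2(S_d)$ is a $(d+1)$-dimensional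 subspace (the face space). $\Pi_{1,\omega_j}:L^2_{\omega_j}(F_j)\to\mathbb P_1(F_j)$ is the orthogonal projection with respect to $\langle\cdot,\cdot\rangle_{\omega_j}$, and $I$ is the identity. *)

(* Defs.v *)
From HB Require Import structures.
From mathcomp Require Import all_boot all_order all_algebra.
(* The notations of mpoly clash with those of MathComp-Analysis. *)
From mathcomp Require Import -(notations) mpoly.
From mathcomp Require Import all_classical all_reals all_analysis measurable_realfun.

Set Implicit Arguments.
Unset Strict Implicit.
Unset Printing Implicit Defensive.

Import Order.TTheory GRing.Theory Num.Theory.
Import numFieldNormedType.Exports.

Local Open Scope classical_set_scope.
Local Open Scope ring_scope.

(* Row vectors carry the product sigma-algebra, generated by the coordinate
   maps; over R this is the Borel sigma-algebra of R^n. *)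
Section measurable_row.
Context {d : measure_display} {T : measurableType d}.
Variable n : nat.

Let coor : 'I_n -> 'rV[T]_n -> T := fun i x => x ord0 i.

Let row_set0 : g_sigma_preimage coor set0.
Proof. exact: sigma_algebra0. Qed.

Let row_setC A : g_sigma_preimage coor A -> g_sigma_preimage coor (~` A).
Proof. exact: sigma_algebraC. Qed.

Let row_bigcup (F : nat -> set 'rV[T]_n) :
  (forall i, g_sigma_preimage coor (F i)) ->
  g_sigma_preimage coor (\bigcup_i (F i)).
Proof. exact: sigma_algebra_bigcup. Qed.

HB.instance Definition _ := @isMeasurable.Build (measure_tuple_display d)
  'rV[T]_n (g_sigma_preimage coor) row_set0 row_setC row_bigcup.

End measurable_row.

Lemma measurable_coor d (T : measurableType d) n (i : 'I_n) :
  measurable_fun [set: 'rV[T]_n] (fun x => x ord0 i).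
Proof.
move=> _ Y mY; rewrite setTI; apply: sub_sigma_algebra => /=.
rewrite -bigcup_seq/=; exists i => /=; first by rewrite mem_index_enum.
by exists Y => //; rewrite setTI.
Qed.

Lemma measurable_fun_row d1 d2 (T1 : measurableType d1)
    (T2 : measurableType d2) n (f : T1 -> 'rV[T2]_n) :
  (forall i, measurable_fun [set: T1] (fun x => f x ord0 i)) ->
  measurable_fun [set: T1] f.
Proof.
move=> mf.
have sub : g_sigma_preimage (fun i x => f x ord0 i) `<=` measurable.
  apply: smallest_sub; first exact: sigma_algebra_measurable.
  case: n => [|n] in f mf *; first by rewrite big_ord0.
  rewrite -bigcup_mkord_ord; apply: bigcup_sub => i Ii.
  by move=> A [B mB <-]; exact: mf.
move=> _ A mA; apply: sub.
rewrite (@g_sigma_preimage_comp _ _ _ _ (fun i (x : 'rV[T2]_n) => x ord0 i)).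
by exists A.
Qed.

Section image_measure.
Context {d1 d2} {T1 : measurableType d1} {T2 : measurableType d2}
  {R : realType} (f : {mfun T1 >-> T2}) (mu : {measure set T1 -> \bar R}).

Definition image_measure : set T2 -> \bar R := pushforward mu f.

Let image_measure0 : image_measure set0 = 0%E.
Proof. exact: measure0. Qed.

Let image_measure_ge0 A : (0 <= image_measure A)%E.
Proof. exact: measure_ge0. Qed.

Let image_measure_sigma_additive : semi_sigma_additive image_measure.
Proof. exact: measure_semi_sigma_additive. Qed.

HB.instance Definition _ := isMeasure.Build _ _ _ image_measure
  image_measure0 image_measure_ge0 image_measure_sigma_additive.

End image_measure.

Lemma sigma_finite_product d1 d2 (T1 : measurableType d1)
    (T2 : measurableType d2) (R : realType)
    (m1 : {sigma_finite_measure set T1 -> \bar R})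
    (m2 : {sigma_finite_measure set T2 -> \bar R}) :
  sigma_finite setT (m1 \x m2)%E.
Proof.
have /sigma_finiteP[F [TF ndF Foo]] := sigma_finiteT m1.
have /sigma_finiteP[G [TG ndG Goo]] := sigma_finiteT m2.
exists (fun n => F n `*` G n).
  rewrite -setXTT TF TG predeqE => -[x y]; split.
    move=> [/= [n _ Fnx] [k _ Gky]]; exists (maxn n k) => //; split.
    - by move: x Fnx; exact/subsetPset/ndF/leq_maxl.
    - by move: y Gky; exact/subsetPset/ndG/leq_maxr.
  by move=> [n _ []/= ? ?]; split; exists n.
move=> k; have [? ?] := Foo k; have [? ?] := Goo k.
split; first exact: measurableX.
by rewrite product_measure1E// lte_mul_pinfty// ge0_fin_numE.
Qed.

Section lebesgue_rV.
Context {R : realType}.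

Definition cons_row n (p : measurableTypeR R * 'rV[R]_n) : 'rV[R]_n.+1 :=
  row_mx (p.1 : R)%:M p.2 : 'rV[R]_(1 + n).

Lemma measurable_cons_row n : measurable_fun setT (@cons_row n).
Proof.
apply: measurable_fun_row => i; rewrite /cons_row.
case: (@splitP 1 n i) => k ik.
  rewrite (_ : (fun _ => _) = fst)//; apply/funext => -[a y] /=.
  have -> : i = lshift n k by exact/val_inj.
  by rewrite [LHS]row_mxEl [k]ord1 mxE mulr1n.
rewrite (_ : (fun _ => _) = (fun y : 'rV[R]_n => y ord0 k) \o snd).
  by apply: measurableT_comp => //; exact: measurable_coor.
apply/funext => -[a y] /=.
have -> : i = rshift 1 k by exact/val_inj.
by rewrite [LHS]row_mxEr.
Qed.

HB.instance Definition _ n :=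
  isMeasurableFun.Build _ _ _ _ (@cons_row n) (@measurable_cons_row n).

Definition uncons_row n (x : 'rV[R]_n.+1) : measurableTypeR R * 'rV[R]_n :=
  (x ord0 ord0, \row_i x ord0 (lift ord0 i)).

Lemma cons_rowK n : cancel (@cons_row n) (@uncons_row n).
Proof.
move=> [a y]; rewrite /uncons_row /cons_row /=; congr pair.
  have -> : ord0 = lshift n ord0 :> 'I_(1 + n) by exact/val_inj.
  by rewrite [LHS]row_mxEl mxE mulr1n.
apply/rowP => i; rewrite mxE.
have -> : lift ord0 i = rshift 1 i :> 'I_(1 + n) by exact/val_inj.
by rewrite [LHS]row_mxEr.
Qed.

Lemma measurable_uncons_row n : measurable_fun setT (@uncons_row n).
Proof.
apply: measurable_fun_pair; first exact: measurable_coor.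
apply: measurable_fun_row => i; under eq_fun do rewrite mxE.
exact: measurable_coor.
Qed.

Section step.
Variables (n : nat) (mu : {sigma_finite_measure set 'rV[R]_n -> \bar R}).

Definition lebesgue_cons : set 'rV[R]_n.+1 -> \bar R :=
  image_measure (@cons_row n) (@lebesgue_measure R \x mu)%E.

HB.instance Definition _ := Measure.on lebesgue_cons.

Let lebesgue_cons_sigma_finite : sigma_finite setT lebesgue_cons.
Proof.
have [F TF Foo] := sigma_finite_product (@lebesgue_measure R) mu.
exists (fun k => @uncons_row n @^-1` F k).
  by rewrite -preimage_bigcup -TF preimage_setT.
move=> k; have [mF Fk] := Foo k; split.
  by rewrite -[X in measurable X]setTI; exact: measurable_uncons_row.
rewrite /lebesgue_cons /image_measure /pushforward -comp_preimage.
by rewrite (_ : _ \o _ = id) ?preimage_id//; apply/funext => x; exact: cons_rowK.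
Qed.

HB.instance Definition _ :=
  Measure_isSigmaFinite.Build _ _ _ lebesgue_cons lebesgue_cons_sigma_finite.

End step.

Fixpoint lebesgue_rV n : {sigma_finite_measure set 'rV[R]_n -> \bar R} :=
  if n is k.+1 then lebesgue_cons (lebesgue_rV k) else \d_(0 : 'rV[R]_0).

End lebesgue_rV.
Arguments lebesgue_rV {R} n.

Section simplex.
Context {R : realType} (k n : nat).
Implicit Types (w : 'I_k.+1 -> 'rV[R]_n) (x : 'rV[R]_n).

Definition edges w : 'M[R]_(k, n) :=
  \matrix_(i < k) (w (lift ord0 i) - w ord0).

Definition nondegenerate_simplex w := row_free (edges w).

Definition simplex w : set 'rV[R]_n :=
  [set x | exists t : 'rV[R]_k.+1, [/\ forall i, 0 <= t ord0 i,
    \sum_i t ord0 i = 1 & x = \sum_i t ord0 i *: w i]].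

(* The defining system has exactly one solution when k = n and w is
   nondegenerate; bary is used only in that case. *)
Definition bary w x : 'rV[R]_k.+1 :=
  xget 0 [set t : 'rV[R]_k.+1 |
    \sum_i t ord0 i = 1 /\ x = \sum_i t ord0 i *: w i].

Definition affine_chart w (y : 'rV[R]_k) : 'rV[R]_n := w ord0 + y *m edges w.

Lemma measurable_affine_chart w : measurable_fun setT (affine_chart w).
Proof.
apply: measurable_fun_row => j; rewrite /affine_chart.
under eq_fun do rewrite mxE mxE.
apply: measurable_funD => //; apply: measurable_sum => i.
by apply: measurable_funM => //; exact: measurable_coor.
Qed.

HB.instance Definition _ w :=
  isMeasurableFun.Build _ _ _ _ (affine_chart w) (measurable_affine_chart w).

(* k-dimensional volume on the affine hull of w: Lebesgue measure of R^k
   transported by the chart, times the Gram factor sqrt (det (E E^T)) given by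
   the area formula. It does not depend on the ordering of the vertices. *)
Definition simplex_volume w : {measure set 'rV[R]_n -> \bar R} :=
  mscale (NngNum (sqrtr_ge0 (\det (edges w *m (edges w)^T))))
    (image_measure (affine_chart w) (lebesgue_rV k)).

End simplex.

(* Functions on a set X are represented by their extension by zero, f \_ X, so
   that equality of functions on X is Leibniz equality. *)

Section polynomials.
Context {R : realType} {n : nat}.
Notation Rn := 'rV[R]_n.
Implicit Types (X : set Rn) (f g : Rn -> R).

Definition poly_fun (p : mpoly.mpoly n R) : Rn -> R :=
  fun x => mpoly.meval (x ord0) p.

(* msize is the total degree plus one *)
Definition poly_space (d : nat) X : set (Rn -> R) :=
  [set f | exists2 p : mpoly.mpoly n R,
    (mpoly.msize p <= d.+1)%N & f = poly_fun p \_ X].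

Context (mu : {measure set Rn -> \bar R}) (X : set Rn) (w : Rn -> R).

Definition is_density :=
  [/\ mu.-integrable X (EFin \o w),
      {ae mu, forall x, X x -> 0 <= w x}
    & (\int[mu]_(x in X) w x = 1)%R].

Definition wdot f g : R := (\int[mu]_(x in X) (f x * g x * w x))%R.

Definition wnorm f : R := Num.sqrt (wdot f f).

Definition S2 : set (Rn -> R) :=
  [set q | poly_space 2 X q /\ forall p, poly_space 1 X p -> wdot q p = 0].

(* Orthogonal projection onto P_1(X), for f square integrable with weight w:
   the p in P_1(X) such that f - p is orthogonal to P_1(X). *)
Definition proj_P1 f : Rn -> R :=
  xget (cst 0) [set p | poly_space 1 X p /\
    forall r, poly_space 1 X r -> wdot (f \- p) r = 0].

End polynomials.

Section bases.
Context {R : realType} {T : Type}.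
Implicit Type W : set (T -> R).

Definition is_basis k W (b : 'I_k -> T -> R) :=
  (forall f, W f <-> exists c : 'I_k -> R, f = fun x => \sum_i c i * b i x) /\
  (forall c : 'I_k -> R,
     (forall x, \sum_i c i * b i x = 0) -> forall i, c i = 0).

Definition has_dim W k := exists b : 'I_k -> T -> R, is_basis W b.

End bases.

Definition argmax {R : realType} {T : Type} (A : set T) (h : T -> R) : set T :=
  [set q | A q /\ forall r, A r -> h r <= h q].

(* Here d = m.+1, so that m is the dimension of the faces. *)
Section faces.
Context {R : realType} {m : nat}.
Variable v : 'I_m.+2 -> 'rV[R]_m.+1.

Definition face_vertices (j : 'I_m.+2) : 'I_m.+1 -> 'rV[R]_m.+1 :=
  fun i => v (lift j i).

Definition face j : set 'rV[R]_m.+1 := simplex (face_vertices j).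

Definition face_volume j : {measure set 'rV[R]_m.+1 -> \bar R} :=
  simplex_volume (face_vertices j).

Definition strip j (e : R) : set 'rV[R]_m.+1 :=
  [set x | simplex v x /\ bary v x ord0 j < e].

(* phi ranges over the functions continuous on the simplex, that is over the
   continuous extensions of the continuous functions on the face. *)
Definition induced_density (Om : 'rV[R]_m.+1 -> R) j
    (om : 'rV[R]_m.+1 -> R) :=
  [/\ is_density (face_volume j) (face j) om,
      {ae face_volume j, forall x, face j x -> 0 < om x}
    & forall phi : 'rV[R]_m.+1 -> R, {within simplex v, continuous phi} ->
        (\int[lebesgue_rV m.+1]_(x in strip j e) (phi x * Om x)) /
        (\int[lebesgue_rV m.+1]_(x in strip j e) Om x) @[e --> 0^'+] -->
        (\int[face_volume j]_(x in face j) (phi x * om x))%R].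

Definition face_space (Om : 'rV[R]_m.+1 -> R) (W : set ('rV[R]_m.+1 -> R)) :=
  W `<=` S2 (lebesgue_rV m.+1) (simplex v) Om /\ has_dim W m.+2.

End faces.

(* Main.v *)
Require Import Defs.
From mathcomp Require Import all_boot all_order all_algebra ring lra.
From mathcomp Require Import -(notations) mpoly.
From mathcomp Require Import all_classical all_reals all_analysis.
From mathcomp Require Import measurable_realfun.

(* On a face F of the simplex the form <f, g> = \int_F f g om is an inner
   product on P_2(F): polynomials are bounded on F, and om > 0 a.e., so <f, f> = 0 forces
   f to vanish almost everywhere on F, hence everywhere by continuity in the
   affine chart. An element q of S_2(F) sees psi only through its residual
   r = (I - Pi_1) psi, since <psi, q> = <r, q>; the theorem is then the equality
   case of Cauchy-Schwarz for r and q. *)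

Set Implicit Arguments.
Unset Strict Implicit.
Unset Printing Implicit Defensive.

Import Order.TTheory GRing.Theory Num.Theory.
Import numFieldNormedType.Exports.

Local Open Scope classical_set_scope.
Local Open Scope ring_scope.

(** * Orthogonal projection and the extremal problem for an abstract inner product *)

Section inner_product.
Context {R : realType} {T : Type}.
Implicit Types (L V : set (T -> R)) (f g h p q : T -> R).

Definition lin_closed L :=
  L (cst 0) /\ forall (a : R) f g, L f -> L g -> L (fun x => a * f x + g x).

Lemma lin_closedZ L a f : lin_closed L -> L f -> L (fun x => a * f x).
Proof.
move=> [L0 LD] Lf; have := LD a _ _ Lf L0.
by under eq_fun do rewrite addr0.
Qed.

Lemma lin_closedB L f g : lin_closed L -> L f -> L g -> L (f \- g).
Proof.
move=> [L0 LD] Lf Lg; have := LD (-1) _ _ Lg Lf.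
by congr L; apply/funext => x /=; ring.
Qed.

(** Recursion on the list lets Gram-Schmidt peel off one generator at a time. The generators may be
    linearly dependent. *)
Fixpoint lin_span (s : seq (T -> R)) : set (T -> R) :=
  if s is b :: s' then
    [set f | exists a g, lin_span s' g /\ f = fun x => a * b x + g x]
  else [set cst 0].

Lemma lin_closed_span s : lin_closed (lin_span s).
Proof.
elim: s => [|b s [IH0 IHD]]; split=> //=.
- by move=> a f g -> ->; apply/funext => x /=; ring.
- by exists 0, (cst 0); split => //; apply/funext => x; rewrite mul0r addr0.
- move=> c _ _ [a1 [g1 [Lg1 ->]]] [a2 [g2 [Lg2 ->]]].
  exists (c * a1 + a2), (fun x => c * g1 x + g2 x); split; first exact: IHD.
  by apply/funext => x /=; ring.
Qed.

Lemma mem_lin_span s : {in s, forall b, lin_span s b}.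
Proof.
elim: s => [|b s IH] // f; rewrite in_cons => /orP[/eqP ->|fs].
  exists 1, (cst 0); split; first exact: (lin_closed_span s).1.
  by apply/funext => x; rewrite mul1r addr0.
exists 0, f; split; first exact: IH.
by apply/funext => x; rewrite mul0r add0r.
Qed.

Lemma lin_span_sub L (s : seq (T -> R)) :
  lin_closed L -> {in s, forall b, L b} -> lin_span s `<=` L.
Proof.
move=> [L0 LD]; elim: s => [|b s IH] sL f /=; first by move=> ->.
move=> [a [g [sg ->]]]; apply: LD; first by apply: sL; rewrite mem_head.
by apply: IH => // h hs; apply: sL; rewrite in_cons hs orbT.
Qed.

Lemma lin_span_sum (I : Type) (r : seq I) (b : I -> T -> R) (c : I -> R) :
  lin_span (map b r) (fun x => \sum_(k <- r) c k * b k x).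
Proof.
elim: r => [|k r IH] /=; first by apply/funext => x; rewrite big_nil.
exists (c k), (fun x => \sum_(j <- r) c j * b j x); split => //.
by apply/funext => x; rewrite big_cons.
Qed.

Variables (V : set (T -> R)) (B : (T -> R) -> (T -> R) -> R).

(** Linearity and positivity are relative to [V], since an integral form is well behaved only where
    products are integrable. Definiteness is Leibniz equality with [cst 0], which suits functions
    extended by zero. *)
Definition inner_product_on := [/\ lin_closed V,
  forall f g, B f g = B g f,
  forall a f g h, V f -> V g -> V h ->
    B (fun x => a * f x + g x) h = a * B f h + B g h,
  forall f, V f -> 0 <= B f f
  & forall f, V f -> B f f = 0 -> f = cst 0].

Hypothesis ipV : inner_product_on.

Let closedV : lin_closed V. Proof. by case: ipV. Qed.
Let Bsym f g : B f g = B g f. Proof. by case: ipV. Qed.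
Let BD a f g h : V f -> V g -> V h ->
  B (fun x => a * f x + g x) h = a * B f h + B g h.
Proof. by case: ipV => _ _ + _ _; apply. Qed.
Let B_ge0 f : V f -> 0 <= B f f. Proof. by case: ipV => _ _ _ + _; apply. Qed.
Let B_eq0 f : V f -> B f f = 0 -> f = cst 0.
Proof. by case: ipV => _ _ _ _; apply. Qed.
Let V0 : V (cst 0). Proof. exact: closedV.1. Qed.

Let B0 h : V h -> B (cst 0) h = 0.
Proof.
move=> Vh; have := BD 1 V0 V0 Vh.
rewrite (_ : (fun x => _) = cst 0); last first.
  by apply/funext => x; rewrite mul1r addr0.
lra.
Qed.

Let BB f g h : V f -> V g -> V h -> B (f \- g) h = B f h - B g h.
Proof.
move=> Vf Vg Vh; have := BD (-1) Vg Vf Vh.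
rewrite (_ : (fun x => _) = f \- g); last by apply/funext => x /=; ring.
by move=> ->; ring.
Qed.

Let BZ a f h : V f -> V h -> B (fun x => a * f x) h = a * B f h.
Proof.
move=> Vf Vh; have := BD a Vf V0 Vh.
by under eq_fun do rewrite addr0; rewrite B0 // addr0.
Qed.

(** Gram-Schmidt by induction on the list. With [g] the projection of [b] onto the span of the tail,
    [e = b \- g] is orthogonal to that span, and the projection of [f] gains the multiple [c] of
    [e]. *)
Lemma projection_span (s : seq (T -> R)) : {in s, forall b, V b} ->
  forall f, V f -> exists2 p, lin_span s p &
    forall r, lin_span s r -> B (f \- p) r = 0.
Proof.
elim: s => [|b s IH] sV f Vf.
  exists (cst 0) => // r /= ->; rewrite Bsym B0 //.
  exact: lin_closedB.
have {}IH : forall f, V f -> exists2 p, lin_span s p &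
    forall r, lin_span s r -> B (f \- p) r = 0.
  by apply: IH => h hs; apply: sV; rewrite in_cons hs orbT.
have sV' : lin_span s `<=` V.
  by apply: lin_span_sub => // h hs; apply: sV; rewrite in_cons hs orbT.
have Vb : V b by apply: sV; rewrite mem_head.
have [g sg bg] := IH _ Vb; have [p sp fp] := IH _ Vf.
have Vg := sV' _ sg; have Vp := sV' _ sp.
set e := b \- g; have Ve : V e by exact: lin_closedB.
pose c := B f e / B e e.
pose p' := fun x => c * e x + p x.
have Vp' : V p' by apply: closedV.2.
have p'E r : V r -> B (f \- p') r = B (f \- p) r - c * B e r.
  by move=> Vr; rewrite (BB Vf Vp' Vr) (BB Vf Vp Vr) BD //; ring.
exists p'.
  exists c, (fun x => (- c) * g x + p x); split.
    exact: (lin_closed_span s).2.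
  by apply/funext => x; rewrite /p' /e /=; ring.
have orth r : lin_span s r -> B (f \- p') r = 0.
  by move=> sr; rewrite p'E; [rewrite fp // bg // mulr0 subr0|exact: sV'].
have orthe : B (f \- p') e = 0.
  rewrite p'E // BB // [B p e]Bsym bg // subr0 /c.
  (* If [b] already lies in the span of the tail, then [e] is zero; the division by zero in [c] is
     harmless because [c] only multiplies [e]. *)
  have [e0|e0] := eqVneq (B e e) 0; last by rewrite divfK ?subrr.
  by rewrite e0 mulr0 subr0 (B_eq0 Ve e0) Bsym B0.
move=> _ [a [r [sr ->]]].
(* Since b = e + g, an element a b + r of the larger span is a e plus an element of the span of the
   tail. *)
rewrite (_ : (fun x => _) =
    fun x => a * e x + (fun x => a * g x + r x) x); last first.
  by apply/funext => x; rewrite /e /=; ring.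
have sr' : lin_span s (fun x => a * g x + r x) by exact: (lin_closed_span s).2.
have Vfp : V (f \- p') by exact: lin_closedB.
rewrite Bsym BD //; last exact: sV'.
by rewrite Bsym orthe mulr0 add0r Bsym orth.
Qed.

Variable L : set (T -> R).
Hypothesis LV : L `<=` V.

(* With u = r / |r|, every unit q orthogonal to L satisfies <f, q> = |r| <u, q>
   and |q - <u, q> u|^2 = 1 - <u, q>^2. *)
Lemma argmax_orthogonal f p : V f -> L p ->
    (forall g, L g -> B (f \- p) g = 0) -> f \- p <> cst 0 ->
  let S := [set q | V q /\ forall g, L g -> B q g = 0] in
  let r := f \- p in
  let norm q := Num.sqrt (B q q) in
  let qstar := fun x => r x / norm r in
  let maximizers := argmax [set q | S q /\ norm q = 1] (fun q => `|B f q|) in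
  [/\ maximizers !=set0,
      forall q1 q2, maximizers q1 -> maximizers q2 -> q1 = q2 \/ q1 = \- q2,
      forall q, maximizers q <-> q = qstar \/ q = \- qstar
    & S qstar /\ norm qstar = 1].
Proof.
move=> Vf Lp fp_orth fp_neq0 S r norm qstar maximizers.
have Vp := LV Lp.
have Vr : V r by exact: lin_closedB.
have r_gt0 : 0 < B r r.
  by rewrite lt_neqAle B_ge0 // andbT eq_sym; apply/eqP => /(B_eq0 Vr).
have nr_gt0 : 0 < norm r by rewrite sqrtr_gt0.
have nr2 : B r r = norm r ^+ 2 by rewrite sqr_sqrtr // ltW.
have qE : qstar = fun x => (norm r)^-1 * r x.
  by apply/funext => x; rewrite /qstar mulrC.
have Vq : V qstar by rewrite qE; exact: lin_closedZ.
have Sq : S qstar.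
  split=> // g Lg; rewrite qE BZ //; last exact: LV.
  by rewrite fp_orth // mulr0.
have BqqE : B qstar qstar = 1.
  rewrite {1}qE BZ // Bsym {1}qE BZ // nr2.
  by field; rewrite gt_eqF.
have nq : norm qstar = 1 by rewrite /norm BqqE sqrtr1.
have BfE q : S q -> B f q = norm r * B qstar q.
  move=> [Vq' qL]; rewrite qE BZ // mulrA divff ?gt_eqF // mul1r.
  by rewrite BB // [B p q]Bsym qL // subr0.
have Bq1 q : norm q = 1 -> V q -> B q q = 1.
  by move=> q1 Vq'; rewrite -[LHS]sqr_sqrtr ?B_ge0 // -/(norm q) q1 expr1n.
have defect q : norm q = 1 -> V q ->
    let e := fun x => (- B qstar q) * qstar x + q x in
    V e /\ B e e = 1 - B qstar q ^+ 2.
  move=> q1 Vq' e; have Ve : V e by exact: closedV.2.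
  split=> //; rewrite {1}/e BD // [B qstar e]Bsym [B q e]Bsym /e !BD //.
  by rewrite BqqE Bq1 // [B q qstar]Bsym; ring.
have le1 q : norm q = 1 -> V q -> `|B qstar q| <= 1.
  move=> q1 Vq'; have [Ve eE] := defect _ q1 Vq'.
  by rewrite -(@expr_le1 _ 2) // real_normK ?num_real // -subr_ge0 -eE B_ge0.
have eq1 q : norm q = 1 -> V q -> `|B qstar q| = 1 ->
    q = qstar \/ q = \- qstar.
  move=> q1 Vq' c1; have [Ve eE] := defect _ q1 Vq'.
  have /(B_eq0 Ve) e0 : B (fun x => - B qstar q * qstar x + q x)
      (fun x => - B qstar q * qstar x + q x) = 0.
    by rewrite eE -real_normK ?num_real // c1 expr1n subrr.
  have qx x : q x = B qstar q * qstar x by move: (congr1 (@^~ x) e0) => /=; lra.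
  move/eqP: c1; rewrite eqr_norml ler01 andbT => /orP[] /eqP c.
  - by left; apply/funext => x; rewrite qx c mul1r.
  - by right; apply/funext => x; rewrite qx c mulN1r.
have maxq : maximizers qstar.
  split=> // q [Sq' q1]; rewrite !BfE // BqqE mulr1 normrM.
  rewrite ger_pMr; first by apply: le1 => //; case: Sq'.
  by rewrite normr_gt0 gt_eqF.
have maxN : maximizers (\- qstar).
  have NE : \- qstar = fun x => (-1) * qstar x.
    by apply/funext => x; rewrite mulN1r.
  have VN : V (\- qstar) by rewrite NE; exact: lin_closedZ.
  have BN g : V g -> B (\- qstar) g = - B qstar g.
    by move=> Vg; rewrite NE BZ // mulN1r.
  split; last first.
    move=> q Aq /=; rewrite [B f (\- _)]Bsym BN // normrN [B qstar f]Bsym.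
    exact: maxq.2.
  split; last by rewrite /norm BN // Bsym BN // opprK BqqE sqrtr1.
  by split=> // g Lg; rewrite BN; [rewrite Sq.2 // oppr0|exact: LV].
have maxE q : maximizers q <-> q = qstar \/ q = \- qstar.
  split=> [[[Sq' q1] qmax]|[->|->]] //; apply: eq1 => //; first by case: Sq'.
  apply/eqP; rewrite eq_le le1 //=; last by case: Sq'.
  (* Comparing [q] with the competitor [qstar] and cancelling the norm of [r] gives the reverse
     inequality 1 <= |<u, q>|. *)
  have := qmax _ maxq.1; rewrite !BfE // BqqE !normrM normr1.
  by rewrite ler_pM2l // normr_gt0 gt_eqF.
split=> //; first by exists qstar.
move=> q1 q2 /maxE[]-> /maxE[]->; [by left|right|by right|by left].
by apply/funext => x; rewrite /= opprK.
Qed.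

End inner_product.

(** * Polynomial functions and the spaces P_k(X) *)

Section polynomial_functions.
Context {R : realType} {n : nat}.
Notation Rn := 'rV[R]_n.
Implicit Types (X : set Rn) (p q : mpoly.mpoly n R).

(** Reduces continuity, measurability and boundedness of polynomials to constants, coordinates, sums
    and products, through the expansion into monomials. *)
Lemma poly_fun_ind (P : set (Rn -> R)) :
  (forall c, P (cst c)) -> (forall i, P (fun x => x ord0 i)) ->
  (forall f g, P f -> P g -> P (f \+ g)) ->
  (forall f g, P f -> P g -> P (f \* g)) ->
  forall p, P (poly_fun p).
Proof.
move=> Pc Px PD PM p.
have PX m : P (fun x => \prod_(i < n) x ord0 i ^+ fun_of_multinom m i).
  elim: (index_enum _) => [|i s IH].
    by under eq_fun do rewrite big_nil; exact: Pc.
  under eq_fun do rewrite big_cons; apply: (PM) => //.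
  elim: (fun_of_multinom m i) => [|k IHk]; first exact: Pc.
  by under eq_fun do rewrite exprS; apply: (PM).
rewrite /poly_fun; under eq_fun do rewrite mevalE.
elim: (msupp p) => [|m s IH] /=.
  by under eq_fun do rewrite big_nil; exact: Pc.
under eq_fun do rewrite big_cons.
by apply: (PD) => //; apply: (PM) => //; exact: Pc.
Qed.

Lemma poly_fun_continuous (U : topologicalType) (h : U -> Rn) p :
  (forall i, continuous (fun u => h u ord0 i)) -> continuous (poly_fun p \o h).
Proof.
move=> ch; apply: (@poly_fun_ind (fun f => continuous (f \o h))) => //.
- by move=> c; exact: cst_continuous.
- by move=> f g cf cg x; exact: (@continuousD R R^o U _ _ x (cf x) (cg x)).
- by move=> f g cf cg x; exact: (@continuousM R U _ _ x (cf x) (cg x)).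
Qed.

Lemma measurable_poly_fun p : measurable_fun setT (poly_fun p).
Proof.
apply: (@poly_fun_ind (fun f => measurable_fun setT f)).
- by move=> c; exact: measurable_cst.
- by move=> i; exact: measurable_coor.
- by move=> f g mf mg; exact: measurable_funD.
- by move=> f g mf mg; exact: measurable_funM.
Qed.

Lemma bounded_poly_fun X p :
  (forall i, exists M, forall x, X x -> `|x ord0 i| <= M) ->
  exists M, forall x, X x -> `|poly_fun p x| <= M.
Proof.
move=> bX.
apply: (@poly_fun_ind (fun f => exists M, forall x, X x -> `|f x| <= M)) => //.
- by move=> c; exists `|c|.
- move=> f g [M fM] [N gN]; exists (M + N) => x Xx.
  by rewrite (le_trans (ler_normD _ _)) // lerD ?fM ?gN.
- move=> f g [M fM] [N gN]; exists (M * N) => x Xx.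
  by rewrite normrM ler_pM ?fM ?gN.
Qed.

Lemma poly_spaceS k l X : (k <= l)%N -> poly_space k X `<=` poly_space l X.
Proof.
by move=> kl _ [p pk ->]; exists p => //; rewrite (leq_trans pk).
Qed.

Lemma lin_closed_poly_space k X : lin_closed (poly_space k X).
Proof.
split.
  exists 0; first by rewrite mmeasure0.
  apply/funext => x; rewrite /patch; case: ifP => // _.
  by rewrite /poly_fun meval0.
move=> a _ _ [p pk ->] [q qk ->]; exists (a *: p + q).
  rewrite (leq_trans (msizeD_le _ _)) // geq_max qk andbT.
  by rewrite (leq_trans (msizeZ_le _ _)).
apply/funext => x; rewrite /patch; case: ifP => _; last by rewrite mulr0 addr0.
by rewrite /poly_fun mevalD mevalZ.
Qed.

(** Supplies the finite generating list that [projection_span] requires. [bmultinom n k.+1] bounds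
    the degree strictly by k + 1; on a thin set such as a face the restricted monomials may be
    dependent. *)
Lemma poly_space_lin_span k X : poly_space k X =
  lin_span [seq poly_fun (mpolyX R (bmnm m)) \_ X | m : bmultinom n k.+1].
Proof.
apply/seteqP; split; last first.
  apply: lin_span_sub; first exact: lin_closed_poly_space.
  move=> _ /mapP[m _ ->]; exists (mpolyX R (bmnm m)) => //.
  by rewrite msizeX; exact: bmdeg.
move=> _ [p pk ->].
have -> : poly_fun p \_ X = fun x =>
    \sum_(m : bmultinom n k.+1)
       mcoeff (bmnm m) p * (poly_fun (mpolyX R (bmnm m)) \_ X) x.
  apply/funext => x; rewrite /patch; case: ifP => _; last first.
    by rewrite big1 // => m _; rewrite mulr0.
  rewrite /poly_fun {1}(mpolywE pk) raddf_sum.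
  by apply: eq_bigr => m _; rewrite /= mevalZ.
by rewrite -[index_enum _]enumT; exact: lin_span_sum.
Qed.

Lemma poly_space_restrict k X Y f :
  Y `<=` X -> poly_space k X f -> poly_space k Y (f \_ Y).
Proof.
move=> YX [p pk ->]; exists p => //; apply/funext => x.
rewrite /patch; case: ifPn => // /set_mem /YX Xx.
by rewrite mem_set.
Qed.

End polynomial_functions.

(** * The weighted integral form is an inner product on P_2(X) *)

Section wdot_inner_product.
Context {R : realType} {n : nat}.
Notation Rn := 'rV[R]_n.
Context (mu : {measure set Rn -> \bar R}) (X : set Rn) (w : Rn -> R).
Hypotheses (mX : measurable X)
  (bX : forall i, exists M, forall x, X x -> `|x ord0 i| <= M)
  (wX : is_density mu X w) (w_gt0 : {ae mu, forall x, X x -> 0 < w x})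
  (aeX : forall p : mpoly.mpoly n R,
    {ae mu, forall x, X x -> poly_fun p x = 0} ->
    forall x, X x -> poly_fun p x = 0).

Let wdotC f g : wdot mu X w f g = wdot mu X w g f.
Proof. by congr Rintegral; apply/funext => x; ring. Qed.

Let intw f g : poly_space 2 X f -> poly_space 2 X g ->
  mu.-integrable X (EFin \o (fun x => f x * g x * w x)).
Proof.
move=> [p _ ->] [q _ ->].
pose h := poly_fun p \* poly_fun q.
apply: (@eq_integrable _ _ _ mu X mX ((EFin \o h) \* (EFin \o w))%E).
  by move=> x xX; rewrite /= /patch xX.
apply: integrableMr => //; last by case: wX.
  apply: measurable_funTS.
  by apply: measurable_funM; exact: measurable_poly_fun.
have [M pM] := bounded_poly_fun p bX; have [N qN] := bounded_poly_fun q bX.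
exists (M * N); split; first exact: num_real.
move=> c Mc x Xx; apply: le_trans (ltW Mc).
by rewrite /h /= normrM ler_pM ?pM ?qN.
Qed.

(** The weight is positive only almost everywhere, so the integrand is replaced by its absolute
    value. This yields positivity and allows the vanishing criterion for integrals of absolute
    values. *)
Let ae_abs f : poly_space 2 X f ->
  wdot mu X w f f = fine (\int[mu]_(x in X) `|(f x * f x * w x)%:E|)%E.
Proof.
move=> Vf; have /measurable_int mf := intw Vf Vf.
congr fine; apply: ae_eq_integral => //; first exact: measurableT_comp.
apply: filterS w_gt0 => x /= wx Xx.
by rewrite ger0_norm // mulr_ge0 ?(ltW (wx Xx)) // -expr2 sqr_ge0.
Qed.

Lemma wdot_inner_product : inner_product_on (poly_space 2 X) (wdot mu X w).
Proof.
split=> //.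
- exact: lin_closed_poly_space.
- move=> a f g h Vf Vg Vh.
  rewrite /wdot -RintegralZl ?intw // -RintegralD ?intw //.
    by congr Rintegral; apply/funext => x; ring.
  exact: (integrableZl mX a (intw Vf Vh)).
- by move=> f Vf; rewrite ae_abs // fine_ge0 // integral_ge0.
- move=> f Vf; rewrite ae_abs // => f0.
  have intf := intw Vf Vf.
  have : (\int[mu]_(x in X) `|(f x * f x * w x)%:E| = 0)%E.
    (* [fine] also sends infinite values to 0; integrability rules these out. *)
    rewrite -[LHS]fineK ?f0 //.
    rewrite ge0_fin_numE ?integral_ge0 //.
    by case/integrableP: intf.
  move/(ae_eq_integral_abs mu mX (measurable_int _ intf)) => ae0.
  case: Vf => p pk fE.
  (* Vanishing on [X] is enough for equality with [cst 0], because [f] is zero outside [X]. *)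
  suff p0 : forall x, X x -> poly_fun p x = 0.
    rewrite fE; apply/funext => x; rewrite /patch.
    by case: ifPn => // /set_mem /p0.
  apply: aeX; apply: filterS2 ae0 w_gt0 => x /= ae0 wx Xx.
  have /eqP := ae0 Xx; rewrite fE /patch mem_set // eqe mulf_eq0.
  by rewrite (gt_eqF (wx Xx)) orbF mulf_eq0 orbb => /eqP.
Qed.

End wdot_inner_product.

(** * Open boxes and their Lebesgue measure *)

Definition row_box {R : realType} {n} (y : 'rV[R]_n) (e : R) : set 'rV[R]_n :=
  [set x : 'rV[R]_n | forall i, `|y ord0 i - x ord0 i| < e].

Lemma measurable_row_box {R : realType} n (y : 'rV[R]_n) e :
  measurable (row_box y e).
Proof.
rewrite (_ : row_box y e = \bigcap_(i in setT)
    (fun x : 'rV[R]_n => x ord0 i) @^-1` ball (y ord0 i) e); last first.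
  by apply/seteqP; split=> [x yx i _|x yx i]; exact: yx.
apply: fin_bigcap_measurable; first exact: finite_finset.
move=> i _; rewrite -[X in measurable X]setTI.
by apply: measurable_coor => //; exact: measurable_ball.
Qed.

(** Induction on the dimension: [cons_row] pulls a box back to an interval times a box of one
    dimension less. In dimension 0 the measure is the Dirac mass at the only point. *)
Lemma lebesgue_rV_box_gt0 {R : realType} n (y : 'rV[R]_n) e : 0 < e ->
  (0 < lebesgue_rV n (row_box y e))%E.
Proof.
move=> e0; elim: n y => [|n IH] y.
  by rewrite [lebesgue_rV 0 _]diracE mem_set ?lte01 //= => -[].
pose y' : 'rV[R]_n := \row_i y ord0 (lift ord0 i).
have preE : @cons_row R n @^-1` row_box y e =
    ball (y ord0 ord0) e `*` row_box y' e.
  apply/seteqP; split=> -[a x].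
    move=> H; have [aE /rowP xE] := cons_rowK (a, x).
    split=> [|i] /=; first by rewrite /ball /= -[X in _ - X]aE; exact: H.
    by rewrite [y' _ _]mxE -xE [X in _ - X]mxE; exact: H.
  have [aE /rowP xE] := cons_rowK (a, x); move=> [ya yx] i.
  have [<-|/unlift_some[j -> _]] := eqVneq ord0 i; first by rewrite aE.
  by move: (yx j); rewrite /= [y' _ _]mxE -xE [X in _ - X]mxE.
rewrite -[lebesgue_rV n.+1 _]/((lebesgue_measure \x lebesgue_rV n)%E
  (@cons_row R n @^-1` row_box y e)) preE product_measure1E //.
- apply: mule_gt0; last exact: IH.
  rewrite [X in (0 < X)%E](lebesgue_measure_ball _ (ltW e0)).
  by rewrite lte_fin pmulrn_lgt0.
- exact: measurable_ball.
- exact: measurable_row_box.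
Qed.

(** * Simplices through their affine charts *)

Section simplex_chart.
Context {R : realType} {k n : nat}.
Implicit Types (w : 'I_k.+1 -> 'rV[R]_n).

(** The total weight is left arbitrary: total 1 gives points of the affine hull, total 0 gives
    affine relations between the vertices. *)
Lemma sum_edges w (t : 'I_k.+1 -> R) :
  \sum_i t i *: w i =
  (\sum_i t i) *: w ord0 + (\row_i t (lift ord0 i)) *m edges w.
Proof.
rewrite mulmx_sum_row !big_ord_recl scalerDl -addrA; congr (_ + _).
rewrite scaler_suml -big_split /=; apply: eq_bigr => i _.
by rewrite rowK mxE scalerBr addrCA subrr addr0.
Qed.

(** The entries are the barycentric coordinates of the vertices other than vertex 0, whose own
    coordinate is the slack in the last inequality. *)
Definition std_simplex : set 'rV[R]_k :=
  [set y | (forall i, 0 <= y ord0 i) /\ \sum_i y ord0 i <= 1].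

Lemma simplexE w : simplex w = affine_chart w @` std_simplex.
Proof.
apply/seteqP; split=> [x [t [t0 t1 ->]]|_ [y [y0 y1] <-]].
  exists (\row_i t ord0 (lift ord0 i)); last by rewrite sum_edges t1 scale1r.
  split=> [i|]; first by rewrite mxE.
  rewrite -t1 big_ord_recl; under eq_bigr do rewrite mxE.
  by rewrite lerDr.
(* The combination of [oapp] and [unlift] inserts the missing coordinate at index 0. *)
exists (\row_i oapp (y ord0) (1 - \sum_j y ord0 j) (unlift ord0 i)).
set t : 'rV[R]_k.+1 := \row__ _.
have tS i : t ord0 (lift ord0 i) = y ord0 i by rewrite mxE liftK.
have t1 : \sum_i t ord0 i = 1.
  by rewrite big_ord_recl (eq_bigr _ (fun i _ => tS i)) mxE unlift_none subrK.
split=> //.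
  by move=> i; rewrite mxE; case: unlift => //=; rewrite subr_ge0.
rewrite sum_edges t1 scale1r /affine_chart; congr (_ + _ *m _).
by apply/rowP => i; rewrite mxE tS.
Qed.

(** Affine independence is symmetric in the vertices, whereas [edges] singles out vertex 0; passing
    to the face opposite vertex 0 changes that base vertex. *)
Lemma nondegenerate_simplexP w : nondegenerate_simplex w <->
  forall t : 'I_k.+1 -> R,
    \sum_i t i = 0 -> \sum_i t i *: w i = 0 -> forall i, t i = 0.
Proof.
split=> [fw t t0|H].
  rewrite sum_edges t0 scale0r add0r => /eqP; rewrite mulmx_free_eq0 //.
  move=> /eqP/rowP tS i.
  have {}tS j : t (lift ord0 j) = 0 by have := tS j; rewrite !mxE.
  have [<-|/unlift_some[j -> _]] := eqVneq ord0 i; last exact: tS.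
  by move: t0; rewrite big_ord_recl big1 ?addr0.
apply: inj_row_free => u u0.
pose t (i : 'I_k.+1) := oapp (u ord0) (- \sum_j u ord0 j) (unlift ord0 i).
have tS i : t (lift ord0 i) = u ord0 i by rewrite /t liftK.
have t0 : \sum_i t i = 0.
  by rewrite big_ord_recl (eq_bigr _ (fun i _ => tS i)) /t unlift_none addNr.
have tw : \sum_i t i *: w i = 0.
  rewrite sum_edges t0 scale0r add0r -[RHS]u0; congr mulmx.
  by apply/rowP => i; rewrite mxE tS.
by apply/rowP => i; rewrite -tS (H t) // mxE.
Qed.

(** A right inverse of the edge matrix gives an affine left inverse [y] of the chart. A point x is
    in the simplex iff [y x] is in the standard simplex and the chart sends [y x] back to x; these
    are inequalities between measurable functions. *)
Lemma measurable_simplex w :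
  nondegenerate_simplex w -> measurable (simplex w).
Proof.
move=> /row_freeP[B EB].
pose y (x : 'rV[R]_n) : 'rV[R]_k := (x - w ord0) *m B.
have yK : cancel (affine_chart w) y.
  by move=> z; rewrite /y /affine_chart addrC addKr -mulmxA EB mulmx1.
have my i : measurable_fun setT (fun x => y x ord0 i).
  rewrite /y; under eq_fun do rewrite mxE.
  apply: measurable_sum => j; apply: measurable_funM => //.
  under eq_fun do rewrite !mxE.
  by apply: measurable_funB => //; exact: measurable_coor.
have mle (f g : 'rV[R]_n -> R) : measurable_fun setT f ->
    measurable_fun setT g -> measurable [set x | f x <= g x].
  by move=> mf mg; rewrite -[X in measurable X]setTI; exact: measurable_fun_le.
have mall (I : finType) (A : I -> set 'rV[R]_n) :
    (forall i, measurable (A i)) -> measurable [set x | forall i, A i x].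
  move=> mA; rewrite (_ : [set x | _] = \bigcap_(i in setT) A i).
    by apply: fin_bigcap_measurable => //; exact: finite_finset.
  by apply/seteqP; split=> x Ax i //; exact: Ax.
have mc j : measurable_fun setT (fun x => affine_chart w (y x) ord0 j).
  have mcy : measurable_fun setT (affine_chart w \o y).
    apply: measurableT_comp; first exact: measurable_affine_chart.
    exact: measurable_fun_row.
  exact: (measurableT_comp (measurable_coor (T := R) j) mcy).
rewrite (_ : simplex w =
    [set x | forall i, 0 <= y x ord0 i] `&`
    [set x | \sum_i y x ord0 i <= 1] `&`
    [set x : 'rV[R]_n | forall j, affine_chart w (y x) ord0 j <= x ord0 j] `&`
    [set x : 'rV[R]_n | forall j, x ord0 j <= affine_chart w (y x) ord0 j]).
  apply: measurableI; [apply: measurableI; [apply: measurableI|]|].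
  - by apply: mall => i; exact: mle.
  - by apply: mle => //; exact: measurable_sum.
  - by apply: mall => j; apply: mle => //; exact: measurable_coor.
  - by apply: mall => j; apply: mle => //; exact: measurable_coor.
rewrite simplexE; apply/seteqP; split=> [_ [z [z0 z1] <-]|x].
  by rewrite /= !yK; do !split.
move=> [[[y0 y1] /= le1] le2]; exists (y x) => //.
by apply/rowP => j; apply/eqP; rewrite eq_le le1 le2.
Qed.

Lemma simplex_bounded w j :
  exists M, forall x, simplex w x -> `|x ord0 j| <= M.
Proof.
exists (\sum_i `|w i ord0 j|) => _ [t [t0 t1 ->]].
rewrite summxE (le_trans (ler_norm_sum _ _ _)) // ler_sum // => i _.
rewrite mxE normrM ler_piMl // ger0_norm // -t1 (bigD1 i) //= lerDl.
exact: sumr_ge0.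
Qed.

(** Since [y0] may lie on the boundary, the box is centred at a nearby point obtained by moving [y0]
    towards the barycentre. *)
Lemma std_simplex_box (y0 : 'rV[R]_k) e : std_simplex y0 -> 0 < e ->
  exists2 yr : 'rV[R]_k * R, 0 < yr.2 &
    row_box yr.1 yr.2 `<=` std_simplex `&` row_box y0 e.
Proof.
move=> [y0_ge0 y0_le1] e0.
pose N : R := k.+1%:R.
have N1 : 1 <= N by rewrite ler1n.
have div_N c : 0 < c -> exists q, [/\ 0 < q, q * N = c & q <= c].
  move=> c0; have N0 : 0 < N by rewrite ltr0n.
  exists (c / N); rewrite divr_gt0 // divfK ?gt_eqF //; split=> //.
  by rewrite ler_pdivrMr // ler_peMr // ltW.
have [s [s0 s1 se]] : exists s, [/\ 0 < s, s <= 1 & 2 * s <= e].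
  exists (Num.min e 1 / 2).
  have m0 : 0 < Num.min e 1 by rewrite lt_min e0 ltr01.
  have [? ?] : Num.min e 1 <= e /\ Num.min e 1 <= 1.
    by rewrite !ge_min !lexx orbT.
  by split; lra.
have [q [q0 qN qs]] := div_N _ s0; have [r [r0 rN rq]] := div_N _ q0.
(* The barycentre has all coordinates 1/N and q = s/N. With r = q/N, coordinate sums in the box are
   at most 1 - s + k (q + r) = 1 - r, and coordinates stay above q - r >= 0. *)
exists (\row_i ((1 - s) * y0 ord0 i + q), r) => //= y yr.
have {}yr i : `|(1 - s) * y0 ord0 i + q - y ord0 i| < r.
  by have := yr i; rewrite mxE.
have y0i1 i : y0 ord0 i <= 1.
  by rewrite (le_trans _ y0_le1) // (bigD1 i) //= lerDl sumr_ge0.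
split; last first.
  move=> i; have := yr i; have := y0i1 i; have := y0_ge0 i.
  rewrite !ltr_norml => h0 h1 /andP[h2 h3].
  have ? : 0 <= s * y0 ord0 i by rewrite mulr_ge0 // ltW.
  have ? : s * y0 ord0 i <= s by rewrite ler_piMr // ltW.
  by apply/andP; split; lra.
split.
  move=> i; have := yr i; rewrite ltr_norml => /andP[_ h].
  have : 0 <= (1 - s) * y0 ord0 i by rewrite mulr_ge0 // subr_ge0.
  lra.
have : \sum_i y ord0 i <= \sum_i ((1 - s) * y0 ord0 i + q + r).
  apply: ler_sum => i _; have := yr i; rewrite ltr_norml => /andP[h _]; lra.
move=> /le_trans; apply.
rewrite !big_split /= -mulr_sumr !sumr_const card_ord.
rewrite -[_ *+ k]mulr_natr -[r *+ k]mulr_natr.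
have -> : k%:R = N - 1 by rewrite /N -natr1 addrK.
have : (1 - s) * \sum_i y0 ord0 i <= 1 - s by rewrite ler_piMr // subr_ge0.
by move: qN rN => <- <-; lra.
Qed.

(* The chart pulls a null set back to a Lebesgue null set, which contains no
   box; near every point of the standard simplex there are boxes inside it. *)
Lemma ae_poly_simplex w (p : mpoly.mpoly n R) :
  \det (edges w *m (edges w)^T) > 0 ->
  {ae simplex_volume w, forall x, simplex w x -> poly_fun p x = 0} ->
  forall x, simplex w x -> poly_fun p x = 0.
Proof.
move=> det_gt0 [A [mA A0 Aae]] x; rewrite simplexE => -[y0 sy0 <-] {x}.
apply: contrapT => /eqP py0.
have cont : continuous (poly_fun p \o affine_chart w).
  apply: poly_fun_continuous => j.
  rewrite /affine_chart; under eq_fun do rewrite !mxE.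
  move=> y; apply: (@continuousD R R^o 'rV[R]_k (cst _)).
    exact: cst_continuous.
  apply: (@cvg_big R^o); first exact: add_continuous.
    exact: (@nbhs_filter 'rV[R]_k).
  move=> i _; apply: (@continuousM R 'rV[R]_k _ (cst _)).
    exact: coord_continuous.
  exact: cst_continuous.
have : nbhs y0 [set y | (poly_fun p \o affine_chart w) y != 0].
  apply: (cont y0 [set z : R | z != 0]); exact: open_nbhs_nbhs.
move=> /nbhs_ballP[e /= e0 ballp].
have [[y1 r] /= r0 box] := std_simplex_box sy0 e0.
have := lebesgue_rV_box_gt0 y1 r0.
have mA' : measurable (affine_chart w @^-1` A).
  by rewrite -[X in measurable X]setTI; exact: measurable_affine_chart.
have -> : lebesgue_rV k (row_box y1 r) = 0%E.
  apply: (@subset_measure0 _ _ _ _ _ (affine_chart w @^-1` A)) => //.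
  - exact: measurable_row_box.
  - move=> y /box[sy y0y]; apply: Aae => /= py.
    have : poly_fun p (affine_chart w y) != 0.
      apply: ballp; split=> // i j; rewrite ord1; exact: y0y.
    by rewrite py ?eqxx // simplexE; exists y.
  (* The Gram factor is positive, so it cancels and the preimage of [A] is Lebesgue null. *)
  - move: A0; rewrite /simplex_volume /mscale /= => /eqP.
    rewrite mule_eq0 eqe sqrtr_eq0 leNgt det_gt0 /=.
    by move=> /eqP.
by rewrite ltxx.
Qed.

End simplex_chart.

(** * Faces of the simplex *)

Section faces.
Context {R : realType} {m : nat}.
Variable v : 'I_m.+2 -> 'rV[R]_m.+1.

Lemma sum_face (A : nmodType) (F : 'I_m.+2 -> A) j :
  \sum_i F i = F j + \sum_i F (lift j i).
Proof. exact: (bigD1_ord j). Qed.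

(** An affine relation between the vertices of the face becomes one between all vertices when given
    coefficient 0 at [j]. *)
Lemma nondegenerate_face j :
  nondegenerate_simplex v -> nondegenerate_simplex (face_vertices v j).
Proof.
move=> /nondegenerate_simplexP fv; apply/nondegenerate_simplexP => t t0 tv i.
pose t' a := oapp t 0 (unlift j a).
have t'E a : t' (lift j a) = t a by rewrite /t' liftK.
have t'j : t' j = 0 by rewrite /t' unlift_none.
rewrite -t'E; apply: fv.
  by rewrite (sum_face _ j) t'j add0r -[RHS]t0; apply: eq_bigr => a _.
rewrite (sum_face _ j) t'j scale0r add0r -[RHS]tv.
by apply: eq_bigr => a _; rewrite t'E.
Qed.

Lemma face_sub j : face v j `<=` simplex v.
Proof.
move=> _ [t [t0 t1 ->]].
exists (\row_i oapp (t ord0) 0 (unlift j i)); set t' := \row__ _.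
have t'E a : t' ord0 (lift j a) = t ord0 a by rewrite mxE liftK.
have t'j : t' ord0 j = 0 by rewrite mxE unlift_none.
split.
- by move=> i; rewrite mxE; case: unlift => /=.
- by rewrite (sum_face _ j) t'j add0r -[RHS]t1; apply: eq_bigr => a _.
- rewrite [RHS](sum_face _ j) t'j scale0r add0r.
  by apply: eq_bigr => a _; rewrite t'E.
Qed.

End faces.

(* A vanishing Gram factor would make the volume, hence the total mass of the
   density, vanish. *)
Lemma density_gram_gt0 {R : realType} k n (w : 'I_k.+1 -> 'rV[R]_n) om :
  measurable (simplex w) -> is_density (simplex_volume w) (simplex w) om ->
  0 < \det (edges w *m (edges w)^T).
Proof.
move=> mF [om_int _ om1]; rewrite ltNge; apply/negP => det_le0.
move: om1; apply/eqP; rewrite eq_sym.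
rewrite (_ : Rintegral _ _ _ = 0) ?oner_neq0 //.
rewrite /Rintegral (@ae_eq_integral _ _ _ _ _ (cst 0%E)) ?integral0 //.
  exact: measurable_int om_int.
(* [Num.sqrt] of a nonpositive number is 0, so the whole space is a null set. *)
exists setT; split=> //.
by apply/eqP; rewrite /simplex_volume /mscale /= mule_eq0 eqe sqrtr_eq0 det_le0.
Qed.

(* d = m.+1; the simplex has vertices v 0, ..., v d *)
Theorem theorem6 (R : realType) (m : nat) (hd : (2 <= m.+1)%N)
  (v : 'I_m.+2 -> 'rV[R]_m.+1) (hv : nondegenerate_simplex v)
  (Om : 'rV[R]_m.+1 -> R)
  (hOm : is_density (lebesgue_rV m.+1) (simplex v) Om)
  (hOm_pos : {ae lebesgue_rV m.+1, forall x, (simplex v)° x -> 0 < Om x})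
  (om : 'I_m.+2 -> 'rV[R]_m.+1 -> R)
  (hom : forall j, induced_density v Om j (om j))
  (W : set ('rV[R]_m.+1 -> R)) (hW : face_space v Om W)
  (psi : 'I_m.+2 -> 'rV[R]_m.+1 -> R) (hpsi : is_basis W psi)
  (i : 'I_m.+2 -> 'I_m.+2)
  (hi : forall j,
     psi (i j) \_ (face v j)
       \- proj_P1 (face_volume v j) (face v j) (om j) (psi (i j) \_ (face v j))
     <> cst 0) :
  forall j : 'I_m.+2,
    let F := face v j in
    let S2F := S2 (face_volume v j) F (om j) in
    let norm := wnorm (face_volume v j) F (om j) in
    let psiF := psi (i j) \_ F in
    let r := psiF \- proj_P1 (face_volume v j) F (om j) psiF in
    let qstar := fun x => r x / norm r in
    let maximizers := argmax [set q | S2F q /\ norm q = 1]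
      (fun q => `| wdot (face_volume v j) F (om j) psiF q |) in
    [/\ maximizers !=set0,
        forall q1 q2, maximizers q1 -> maximizers q2 ->
          q1 = q2 \/ q1 = \- q2,
        forall q, maximizers q <-> q = qstar \/ q = \- qstar
      & S2F qstar /\ norm qstar = 1].
Proof.
move=> j; set F := face v j; set mu := face_volume v j.
have mF : measurable F by apply: measurable_simplex; exact: nondegenerate_face.
have [om_dens om_gt0 _] := hom j.
have ipF : inner_product_on (poly_space 2 F) (wdot mu F (om j)).
  apply: wdot_inner_product => //; first exact: simplex_bounded.
  by move=> p; apply: ae_poly_simplex; exact: density_gram_gt0 om_dens.
have L12 : poly_space 1 F `<=` poly_space 2 F by exact: poly_spaceS.
have Vpsi : poly_space 2 F (psi (i j) \_ F).
  apply: (@poly_space_restrict _ _ _ (simplex v)); first exact: face_sub.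
  (* [W] is contained in S_2 of the simplex, hence in P_2; a basis element belongs to [W] through
     Kronecker coefficients. *)
  suff /hW.1[] : W (psi (i j)) by [].
  apply/hpsi.1; exists (fun k => (k == i j)%:R); apply/funext => x.
  rewrite (bigD1 (i j)) //= eqxx mul1r big1 ?addr0 // => k /negPf ->.
  by rewrite mul0r.
(* [proj_P1] is an [xget] with default [cst 0]; existence of a projection ensures that the chosen
   value satisfies the orthogonality conditions. *)
have [p Lp p_orth] : exists2 p, poly_space 1 F p &
    forall r, poly_space 1 F r -> wdot mu F (om j) (psi (i j) \_ F \- p) r = 0.
  rewrite poly_space_lin_span; apply: (projection_span ipF) Vpsi => b bs.
  by apply: L12; rewrite poly_space_lin_span; exact: mem_lin_span.
pose proj := [set q | poly_space 1 F q /\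
  forall r, poly_space 1 F r -> wdot mu F (om j) (psi (i j) \_ F \- q) r = 0].
have [Lproj proj_orth] : proj (xget (cst 0) proj) by apply: xgetPex; exists p.
exact: (argmax_orthogonal ipF L12 Vpsi Lproj proj_orth (hi j)).
Qed.
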